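(* Let $n$ and $k$ be positive integers with $n \geq 2k \geq 4$ and $n \geq 2k^3-2k^2-2k+4$. Then $\chi_s(\mathrm{KG}(n,k)) = \chi_s(\mathrm{KG}(n-1,k)) + 2$.
   Context: For $n \geq 2k$, the Kneser graph $\mathrm{KG}(n,k)$ is the graph whose vertices are the $k$-element subsets of $[n]=\{1,\ldots,n\}$, two vertices $A,B$ being adjacent iff $A\cap B=\emptyset$. A star-free coloring of a graph $G$ is a proper coloring $c: V(G)\to\mathbb{N}$ such that no path on three vertices is colored with just two consecutive integers. The star-free chromatic number $\chi_s(G)$ is the minimum positive integer $t$ such that there is a star-free coloring $c: V(G)\to\{1,\ldots,t\}$. *)

(* Defs.v *)
From mathcomp Require Import all_boot.
From mathcomp Require Import boolp.

Set Implicit Arguments.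
Unset Strict Implicit.
Unset Printing Implicit Defensive.

Record sgraph := SGraph {
  vertex :> finType;
  adj : rel vertex;
  adj_sym : symmetric adj;
  adj_irr : irreflexive adj
}.

Definition proper_coloring (G : sgraph) (c : G -> nat) : Prop :=
  forall u v : G, adj u v -> c u <> c v.

(* The path need not be induced; u != v and v != w follow from irreflexivity. *)
Definition path3 (G : sgraph) (u v w : G) : Prop :=
  [/\ adj u v, adj v w & u != w].

Definition star_free_coloring (G : sgraph) (c : G -> nat) : Prop :=
  proper_coloring c /\
  forall u v w : G, path3 u v w ->
    ~ exists i : nat,
        forall x : G, x \in [:: u; v; w] -> c x = i \/ c x = i.+1.

Definition star_free_colorable (G : sgraph) (t : nat) : Prop :=
  exists c : G -> nat,
    star_free_coloring c /\ forall v : G, 1 <= c v <= t.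

Lemma star_free_colorable_exists (G : sgraph) :
  exists t : nat, (0 < t) && `[< star_free_colorable G t >].
Proof.
exists #|G|.+1; apply/asboolP; exists (fun v => (enum_rank v).+1).
have inj (u v : G) : (enum_rank u).+1 = (enum_rank v).+1 -> u = v.
  by case=> /ord_inj /enum_rank_inj.
split; last by move=> v /=; rewrite ltnS ltnW.
split=> [u v uv /inj e|u v w [uv vw uw] [i ci]].
  by move: uv; rewrite e adj_irr.
have uv' : u <> v by move=> e; move: uv; rewrite e adj_irr.
have vw' : v <> w by move=> e; move: vw; rewrite e adj_irr.
have uw' : u <> w by apply/eqP.
have cu : _ \/ _ := ci u (mem_head _ _).
have cv : _ \/ _ := ci v ltac:(by rewrite !inE eqxx orbT).
have cw : _ \/ _ := ci w ltac:(by rewrite !inE eqxx !orbT).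
by case: cu cv cw => a [] b [] d;
  first [apply: uv'; apply: inj; congruence
        |apply: vw'; apply: inj; congruence
        |apply: uw'; apply: inj; congruence].
Qed.

Definition star_free_chromatic (G : sgraph) : nat :=
  ex_minn (star_free_colorable_exists G).

(* The ground set {1, ..., n} is rendered as 'I_n. *)
Definition ksubset (n k : nat) : finType := {A : {set 'I_n} | #|A| == k}.

(* The conjunct A != B only matters for k = 0: for k > 0 a k-set is never
   disjoint from itself. *)
Definition kneser_adj (n k : nat) : rel (ksubset n k) :=
  fun A B => (A != B) && (val A :&: val B == set0).

Lemma kneser_adj_sym (n k : nat) : symmetric (@kneser_adj n k).
Proof. by move=> A B; rewrite /kneser_adj eq_sym setIC. Qed.

Lemma kneser_adj_irr (n k : nat) : irreflexive (@kneser_adj n k).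
Proof. by move=> A; rewrite /kneser_adj eqxx. Qed.

Definition kneser (n k : nat) : sgraph :=
  SGraph (@kneser_adj_sym n k) (@kneser_adj_irr n k).

(* Main.v *)
Require Import Defs.
From mathcomp Require Import all_boot.
From mathcomp Require Import boolp zify.

(* Deleting a point x frees two colors as soon as some color class i is contained,
   together with the classes i - 1 and i + 1, in the star of x: after
   deleting x three consecutive colors are free, and one of them suffices to
   keep the remaining two blocks of colors apart.

   Assume t <= s = 2n - 4k + 1 colors are used, which is the case if
   chi_s(KG(n,k)) <= chi_s(KG(n-1,k)) + 1, since KG(2k,k) is a matching and each
   new point costs at most two colors. Some class has at least C(n,k) / s
   members. An intersecting family without common point is smaller than that,
   by a crude form of the Hilton-Milner theorem (valid since n is large): we
   count according to the number of pairs {x, y} that meet all the members. So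
   the class lies in the star of some x. A set B without x in a neighboring
   class is disjoint from at most one member of the class, which again would
   make the class too small. *)

Set Implicit Arguments.
Unset Strict Implicit.
Unset Printing Implicit Defensive.

(** * Degrees of uniform families and hitting sets *)

Definition deg (T : finType) (F : {set {set T}}) (S : {set T}) : nat :=
  #|[set A in F | S \subset A]|.

Definition uniform (T : finType) (k : nat) (F : {set {set T}}) : Prop :=
  {in F, forall A : {set T}, #|A| = k}.

Definition intersecting (T : finType) (F : {set {set T}}) : Prop :=
  {in F &, forall A B : {set T}, A :&: B != set0}.

Definition nontrivial (T : finType) (F : {set {set T}}) : Prop :=
  forall x : T, exists2 A, A \in F & x \notin A.

(* Number of [k]-subsets of an [n]-set containing a given [j]-subset; unlike
   ['C(n - j, k - j)], this is correctly [0] for [k < j <= n]. *)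
Definition codeg (n k j : nat) : nat := 'C(n - j, n - k).

Lemma deg_le (T : finType) (k : nat) (F : {set {set T}}) (S : {set T}) :
  k <= #|T| -> uniform k F -> deg F S <= codeg #|T| k #|S|.
Proof.
move=> kT unifF; rewrite /deg -(card_imset _ (@setC_inj T)) /codeg.
have -> : #|T| - #|S| = #|~: S| by rewrite [RHS]cardsCs setCK.
rewrite -cards_draws; apply/subset_leq_card/subsetP => _ /imsetP[A + ->].
rewrite !inE => /andP[AF SA]; rewrite setCS SA /=.
by rewrite cardsCs setCK (unifF A AF).
Qed.

(** Union bound over the points of [B]. Repeated branching on the points of a member of an
    intersecting family drives the estimates below. *)
Lemma card_hitting (T : finType) (G : {set {set T}}) (B : {set T})
    (u : T -> nat) :
  {in G, forall A : {set T}, A :&: B != set0} ->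
  {in B, forall b, #|[set A in G | b \in A]| <= u b} ->
  #|G| <= \sum_(b in B) u b.
Proof.
move=> hit Hu; apply: leq_trans (leq_sum _ Hu).
under eq_bigr => b _ do rewrite -sum1_card.
rewrite (exchange_big_dep (mem G)) /=; last first.
  by move=> b A _; rewrite inE => /andP[].
rewrite -sum1_card; apply: leq_sum => A AG.
have /set0Pn[b /setIP[bA bB]] := hit A AG.
by rewrite (bigD1 b) //= bB inE AG.
Qed.

(** A member through [x] and [y] meets [D] in a third point, so it contains one of [#|D|] triples.
    In the uses, [D] is a member missing both points, possibly shortened by one element. *)
Lemma deg_pair_le (T : finType) (k : nat) (F : {set {set T}})
    (D : {set T}) (x y : T) :
  k <= #|T| -> uniform k F -> x != y -> x \notin D -> y \notin D ->
  {in F, forall A : {set T}, x \in A -> y \in A -> A :&: D != set0} ->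
  deg F [set x; y] <= #|D| * codeg #|T| k 3.
Proof.
move=> kT unifF xy xD yD hit; rewrite -sum_nat_const; apply: card_hitting.
  by move=> A; rewrite inE subUset !sub1set => /andP[AF /andP[xA yA]]; apply: hit.
move=> b bD; have <- : #|[set x; y; b]| = 3.
  rewrite setUC cardsU1 cards2 xy !inE negb_or.
  by rewrite (contraTneq _ bD) => [|->]; rewrite ?(contraTneq _ bD) // => ->.
apply: leq_trans (deg_le _ kT unifF); apply/subset_leq_card/subsetP => A.
by rewrite !inE !subUset !sub1set -andbA => /andP[-> /andP[-> ->]].
Qed.

Lemma deg1_le (T : finType) (k : nat) (F : {set {set T}}) (x : T) (B : {set T}) :
  k <= #|T| -> uniform k F -> x \notin B ->
  {in F, forall A : {set T}, x \in A -> A :&: B != set0} ->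
  deg F [set x] <= #|B| * codeg #|T| k 2.
Proof.
move=> kT unifF xB hit; rewrite -sum_nat_const; apply: card_hitting.
  by move=> A; rewrite inE sub1set => /andP[AF xA]; apply: hit.
move=> b bB; have <- : #|[set x; b]| = 2.
  by rewrite cards2 (contraNneq _ xB) // => ->.
apply: leq_trans (deg_le _ kT unifF); apply/subset_leq_card/subsetP => A.
by rewrite !inE !subUset !sub1set -andbA => /andP[-> /andP[-> ->]].
Qed.

(** * Pairs that meet all members, and the resulting size bounds *)

Definition copartners (T : finType) (F : {set {set T}}) (x : T) : {set T} :=
  [set y | [forall A in F, (x \in A) || (y \in A)]].

Lemma copartnersP (T : finType) (F : {set {set T}}) (x y : T) :
  reflect {in F, forall A : {set T}, x \notin A -> y \in A} (y \in copartners F x).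
Proof.
rewrite inE; apply: (iffP forall_inP) => H A AF; first by case/orP: (H A AF) => // ->.
by rewrite -implyNb; apply/implyP/H.
Qed.

Lemma notin_copartners (T : finType) (F : {set {set T}}) (x y : T) :
  y \notin copartners F x -> exists2 A, A \in F & (x \notin A) && (y \notin A).
Proof.
rewrite inE => /forall_inPn[A AF]; rewrite negb_or => H.
by exists A.
Qed.

Lemma copartners_sub (T : finType) (F : {set {set T}}) (x : T) (B : {set T}) :
  B \in F -> x \notin B -> copartners F x \subset B.
Proof. by move=> BF xB; apply/subsetP => y /copartnersP; apply. Qed.

(** Branch three times: on [x] in a member, on [y] in a member avoiding [x], and on a point of a
    member avoiding both, which exists since no pair meets everything. *)
Lemma card_no_cover (T : finType) (k : nat) (F : {set {set T}}) :
  k <= #|T| -> uniform k F -> intersecting F ->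
  F != set0 -> (forall x, copartners F x = set0) ->
  #|F| <= k ^ 3 * codeg #|T| k 3.
Proof.
move=> kT unifF intF /set0Pn[A0 A0F] Y0.
have miss x y : exists2 A, A \in F & (x \notin A) && (y \notin A).
  by apply: notin_copartners; rewrite Y0 inE.
rewrite expnS -mulnA -{1}(unifF A0 A0F) -sum_nat_const.
apply: card_hitting => [A AF|x xA0]; first exact: intF.
have [B BF /andP[xB _]] := miss x x.
rewrite expnS expn1 -mulnA -{1}(unifF B BF) -sum_nat_const.
apply: card_hitting => [A|y yB].
  by rewrite inE => /andP[AF _]; apply: intF.
have [D DF /andP[xD yD]] := miss x y.
have xy : x != y by apply: contraNneq xB => ->.
apply: (@leq_trans (deg F [set x; y])).
  apply/subset_leq_card/subsetP => A.
  by rewrite !inE subUset !sub1set -andbA.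
rewrite -{1}(unifF D DF).
by apply: (deg_pair_le kT unifF xy xD yD) => A AF _ _; apply: intF.
Qed.

(** Members avoiding [x] contain all copartners, which gives the last term. Members through [x] meet
    a fixed [B] avoiding [x]: a copartner in [B] costs a pair codegree, and for any other point some
    member misses it and [x], so triples can be counted. *)
Lemma card_many_copartners (T : finType) (k : nat) (F : {set {set T}}) (x : T) :
  k <= #|T| -> uniform k F -> intersecting F -> nontrivial F ->
  let m := #|copartners F x| in 2 < m ->
  m <= k /\
  #|F| <= m * codeg #|T| k 2 + (k - m) * (k * codeg #|T| k 3) + codeg #|T| k m.
Proof.
move=> kT unifF intF ntF m m3; set Y := copartners F x in m m3 *.
have [B BF xB] := ntF x; have YB : Y \subset B by apply: copartners_sub.
have mk : m <= k by rewrite -(unifF B BF) subset_leq_card.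
split=> //.
rewrite -(cardsID [set A : {set T} | x \in A] F); apply: leq_add; last first.
  apply: leq_trans (deg_le Y kT unifF); apply/subset_leq_card/subsetP => A.
  rewrite !inE => /andP[xA AF]; rewrite AF; exact: copartners_sub.
have -> : k - m = #|B :\: Y| by rewrite cardsD (setIidPr YB) (unifF B BF).
rewrite -!sum_nat_const.
have -> : \sum_(b in Y) codeg #|T| k 2 + \sum_(b in B :\: Y) k * codeg #|T| k 3
   = \sum_(b in B) if b \in Y then codeg #|T| k 2 else k * codeg #|T| k 3.
  rewrite [RHS](big_setID Y) /= (setIidPr YB); congr addn; apply: eq_bigr => b.
    by move=> ->.
  by rewrite inE => /andP[/negPf->].
apply: card_hitting => [A|b bB].
  by rewrite !inE => /andP[AF _]; apply: intF.
have xb : x != b by apply: contraNneq xB => ->.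
have sub : #|[set A in F :&: [set A : {set T} | x \in A] | b \in A]|
    <= deg F [set x; b].
  apply/subset_leq_card/subsetP => A.
  by rewrite !inE subUset !sub1set -andbA.
apply: leq_trans sub _; case: ifPn => [_|/notin_copartners[D DF /andP[xD bD]]].
  by apply: leq_trans (deg_le _ kT unifF) _; rewrite cards2 xb.
by rewrite -{1}(unifF D DF); apply: deg_pair_le => // A AF _ _; apply: intF.
Qed.

(** Members without [y] meet each member outside [y], so hitting sets shrink to [k - 1] points. A
    member avoiding [x] contains [y], and at most one of its other points is a copartner of [x];
    only that one costs a pair codegree. *)
Lemma card_avoiding_partner (T : finType) (k : nat) (F : {set {set T}}) (x y : T) :
  k <= #|T| -> uniform k F -> intersecting F -> nontrivial F ->
  y \in copartners F x -> #|copartners F x| <= 2 ->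
  #|[set A in F | (x \in A) && (y \notin A)]|
    <= codeg #|T| k 2 + k.-1 ^ 2 * codeg #|T| k 3.
Proof.
move=> kT unifF intF ntF yY Y2; set Y := copartners F x in yY Y2 *.
have meetD A D : A \in F -> D \in F -> y \notin A -> A :&: (D :\ y) != set0.
  move=> AF DF yA; have /set0Pn[z /setIP[zA zD]] := intF A D AF DF.
  by apply/set0Pn; exists z; rewrite !inE zA zD andbT (contraNneq _ yA) // => <-.
have [B BF xB] := ntF x; have yB : y \in B by move/copartnersP: yY; apply.
have cardD D : D \in F -> y \in D -> #|D :\ y| = k.-1.
  by move=> DF yD; rewrite cardsDS ?sub1set // cards1 (unifF D DF) subn1.
apply: (@leq_trans (\sum_(b in B :\ y)
    ((b \in Y) * codeg #|T| k 2 + k.-1 * codeg #|T| k 3))).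
  apply: card_hitting => [A|b].
    by rewrite inE => /and3P[AF _ yA]; apply: meetD.
  rewrite in_setD1 => /andP[_ bB].
  have xb : x != b by apply: contraNneq xB => ->.
  pose G := [set A in F | y \notin A].
  have unifG : uniform k G by move=> A; rewrite inE => /andP[/unifF].
  have sub : #|[set A in [set A in F | (x \in A) && (y \notin A)] | b \in A]|
      <= deg G [set x; b].
    apply/subset_leq_card/subsetP => A; rewrite !inE subUset !sub1set.
    by case/andP=> /and3P[-> -> ->] ->.
  apply: (leq_trans sub); rewrite /=; have [bY|bY] := boolP (b \in Y).
    rewrite mul1n; apply: leq_trans (leq_addr _ _).
    by apply: leq_trans (deg_le _ kT unifG) _; rewrite cards2 xb.
  have [D DF /andP[xD bD]] := notin_copartners bY.
  have yD : y \in D by move/copartnersP: yY; apply.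
  rewrite add0n -(cardD D DF yD); apply: deg_pair_le => //.
  - by rewrite !inE negb_and xD orbT.
  - by rewrite !inE negb_and bD orbT.
  - by move=> A; rewrite inE => /andP[AF yA] _ _; apply: meetD.
rewrite big_split /= sum_nat_const (cardD B BF yB) mulnA mulnn -big_distrl /=.
rewrite leq_add2r -[leqRHS]mul1n leq_mul2r; apply/orP; right.
rewrite -big_mkcondr /= sum1_card.
have : #|Y :\ y| <= 1 by rewrite cardsDS ?sub1set // cards1 leq_subLR.
apply: leq_trans; apply/subset_leq_card/subsetP => b.
by rewrite unfold_in /= !in_setD1 => /andP[/andP[-> _] ->].
Qed.

(** Each member contains both of [x], [y] or exactly one of them. Being a copartner is symmetric, so
    the previous bound applies in both directions. *)
Lemma card_few_copartners (T : finType) (k : nat) (F : {set {set T}}) (x y : T) :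
  k <= #|T| -> uniform k F -> intersecting F -> nontrivial F ->
  y \in copartners F x -> (forall z, #|copartners F z| <= 2) ->
  #|F| <= 3 * codeg #|T| k 2 + 2 * (k.-1 ^ 2 * codeg #|T| k 3).
Proof.
move=> kT unifF intF ntF yY Y2.
have xY : x \in copartners F y.
  apply/copartnersP => A AF; apply: contraR => xA.
  by move/copartnersP: yY; apply.
have xy : x != y.
  have [A AF xA] := ntF x; apply: contraNneq (xA) => exy.
  by rewrite {1}exy; move/copartnersP: yY; apply.
have Fx := card_avoiding_partner kT unifF intF ntF yY (Y2 x).
have Fy := card_avoiding_partner kT unifF intF ntF xY (Y2 y).
have Fxy : deg F [set x; y] <= codeg #|T| k 2.
  by have := deg_le [set x; y] kT unifF; rewrite cards2 xy.
have : #|F| <= deg F [set x; y] + #|[set A in F | (x \in A) && (y \notin A)]|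
    + #|[set A in F | (y \in A) && (x \notin A)]|; last by lia.
apply: (@leq_trans #|[set A in F | [set x; y] \subset A]
    :|: [set A in F | (x \in A) && (y \notin A)]
    :|: [set A in F | (y \in A) && (x \notin A)]|).
  apply/subset_leq_card/subsetP => A AF.
  rewrite !inE AF subUset !sub1set /=.
  have [xA|xA] := boolP (x \in A); first by case: (y \in A).
  by rewrite /= andbT; move/copartnersP: yY; apply.
by rewrite /deg; apply: leq_trans (leq_card_setU _ _) _; rewrite leq_add2r leq_card_setU.
Qed.

(** * Numerical estimates for codegrees *)

Lemma codeg23 (n k : nat) : 2 <= k -> k <= n -> 2 < n ->
  (n - 2) * codeg n k 3 = (k - 2) * codeg n k 2.
Proof.
move=> k2 kn n2; rewrite /codeg.
have -> : n - 3 = (n - 2).-1 by lia.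
by rewrite mul_bin_down; congr (_ * _); lia.
Qed.

Lemma codeg02 (n k : nat) : 2 <= k -> k <= n ->
  n * (n - 1) * codeg n k 2 = k * (k - 1) * 'C(n, k).
Proof.
move=> k2 kn; rewrite /codeg -(bin_sub kn).
have -> : n - 2 = (n - 1).-1 by lia.
rewrite -mulnA mul_bin_down mulnCA.
have -> : n - 1 = n.-1 by lia.
rewrite mul_bin_down mulnCA mulnA; congr (_ * _ * _); lia.
Qed.

(** The ratio of the two codegrees is [(k - 2) / (n - 2)], so for large [n] a factor [L] is
    absorbed. *)
Lemma codeg3_le (n k L : nat) : 2 <= k -> k <= n -> 2 < n -> L * (k - 2) <= n - 2 ->
  L * codeg n k 3 <= codeg n k 2.
Proof.
move=> k2 kn n2 HL; rewrite -(@leq_pmul2l (n - 2)); last by lia.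
by rewrite mulnCA codeg23 // mulnA leq_mul2r HL orbT.
Qed.

Definition order_bound (k : nat) : nat := 2 * k ^ 3 - 2 * k ^ 2 - 2 * k + 4.

(** Substituting [k = q + 2] removes the truncated subtractions and leaves nonnegative
    coefficients. *)
Lemma order_bound_expand (q r n : nat) : order_bound q.+2 + r = n ->
  n = 2 * (q * q * q) + 10 * (q * q) + 14 * q + 8 + r.
Proof. rewrite /order_bound !expnS expn0; nia. Qed.

Lemma hilton_milner_lt (n k : nat) : 2 <= k -> order_bound k <= n ->
  (2 * n - 4 * k + 1) * (k * codeg n k 2 + 1) < 'C(n, k).
Proof.
move=> k2 hn.
have [q [r [ek en]]] : exists q r, k = q.+2 /\
    n = 2 * (q * q * q) + 10 * (q * q) + 14 * q + 8 + r.
  exists (k - 2), (n - order_bound k); split; first lia.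
  by apply: order_bound_expand; rewrite -[RHS](subnKC hn); congr (order_bound _ + _); lia.
have kn : k <= n by nia.
have e23 := @codeg23 n k k2 kn ltac:(nia).
have e02 := @codeg02 n k k2 kn.
have c3 : 2 < k -> 0 < codeg n k 3 by move=> q0; rewrite /codeg bin_gt0; lia.
have c2 : 0 < codeg n k 2 by rewrite /codeg bin_gt0; lia.
rewrite -(@ltn_pmul2l (k * (k - 1))) -?e02; last by rewrite muln_gt0; lia.
move: e23 c3 c2; set c := codeg n k 2; set d := codeg n k 3 => e23 c3 c2.
(* For [k = 2], [q = 0] and [key] below would fail. *)
have [e|k3] := eqVneq k 2.
  have -> : c = 1 by rewrite /c /codeg e binn.
  have q0 : q = 0 by lia.
  by rewrite e en q0; nia.
(* This turns the contribution of the summand [1] into a multiple of [c], so that [c] cancels and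
   only the polynomial inequality [main] remains. *)
have key : 2 * n - 4 * k + 1 <= 2 * q * c.
  have : n - 2 <= q * c.
    by have -> : q = k - 2; [lia | rewrite -e23 leq_pmulr // c3; lia].
  by rewrite -mulnA; lia.
have main : k * (k - 1) * ((2 * n - 4 * k + 1) * k + 2 * q) < n * (n - 1).
  have -> : n - 1 = 2 * (q * q * q) + 10 * (q * q) + 14 * q + 7 + r by nia.
  have -> : 2 * n - 4 * k + 1 = 
      4 * (q * (q * q)) + 20 * (q * q) + 24 * q + 9 + 2 * r by nia.
  have -> : k - 1 = q.+1 by lia.
  rewrite ltnNge; apply/negP => H.
  (* The difference of the two sides of [main], expanded in [q] and [r], has
     only positive coefficients. *)
  pose p := 20 + 7 * r + r * r + 38 * q + 12 * (q * r) + 23 * (q * q)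
    + 10 * (q * q * r) + 3 * (q * q * q) + 2 * (q * q * q * r).
  have : n * (2 * (q * q * q) + 10 * (q * q) + 14 * q + 7 + r) = k * q.+1 *
      ((4 * (q * (q * q)) + 20 * (q * q) + 24 * q + 9 + 2 * r) * k + 2 * q) + p.
    by rewrite en ek /p; lia.
  by move=> E; move: H; rewrite E -[leqRHS]addn0 leq_add2l /p leqn0 !addn_eq0.
apply: leq_ltn_trans (_ : k * (k - 1) * ((2 * n - 4 * k + 1) * k + 2 * q) * c < _).
  rewrite -(mulnA _ _ c) leq_mul2l; apply/orP; right.
  set s := _ - _ + 1 in key *.
  by rewrite mulnDr mulnDl muln1 mulnA leq_add2l.
by rewrite ltn_mul2r c2.
Qed.

Lemma lt_bin_of_codeg_le (n k X : nat) :
  2 <= k -> order_bound k <= n -> X <= k * codeg n k 2 + 1 ->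
  (2 * n - 4 * k + 1) * X < 'C(n, k).
Proof.
by move=> k2 hn HX; apply: leq_ltn_trans (hilton_milner_lt k2 hn); rewrite leq_mul2l HX orbT.
Qed.

(** The first two bounds let [codeg3_le] absorb the factors [2 * k.-1 ^ 2] and [k ^ 2]; the third
    allows a point to be deleted. *)
Lemma order_bound_ge (k n : nat) :
  2 <= k -> order_bound k <= n ->
  2 * (k.-1 ^ 2 * (k - 2)) + 6 <= n /\
  k ^ 3 - 2 * k ^ 2 + 2 <= n /\ 2 * k <= n - 1.
Proof. rewrite /order_bound; case: k => [|[|q]] // _ /=; rewrite !expnS !expn0; nia. Qed.

Lemma codeg_decreasing (n k i j : nat) : i <= j -> codeg n k j <= codeg n k i.
Proof. by move=> ij; apply: leq_bin2l; lia. Qed.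

(** * The crude Hilton-Milner bound *)

Lemma nontrivial_card_small (T : finType) (k : nat) (F : {set {set T}}) :
  2 <= k -> order_bound k <= #|T| ->
  uniform k F -> intersecting F -> nontrivial F ->
  (2 * #|T| - 4 * k + 1) * #|F| < 'C(#|T|, k).
Proof.
move=> k2 hn unifF intF ntF.
have [h1 [h2 h3]] := order_bound_ge k2 hn.
have kT : k <= #|T| by lia.
have c3le L : L * (k - 2) <= #|T| - 2 -> L * codeg #|T| k 3 <= codeg #|T| k 2.
  by apply: codeg3_le => //; lia.
have [F0|Fn0] := eqVneq F set0.
  by rewrite F0 cards0 muln0 bin_gt0.
have [/existsP[x Yx]|many] := boolP [exists x, 2 < #|copartners F x|].
  apply: lt_bin_of_codeg_le => //.
  have [] := card_many_copartners kT unifF intF ntF Yx.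
  set m := #|_| in Yx *; move=> mk HF; apply: leq_trans HF _.
  have [e|mk'] := eqVneq m k.
    by rewrite e subnn mul0n addn0 /codeg binn.
  (* Since [m < k], the term [codeg #|T| k m] is at most [k - m] triple codegrees; hence the factor
     [k.+1], absorbed into [k - m] pair codegrees. *)
  have cm := codeg_decreasing #|T| k Yx.
  by have := c3le k.+1 ltac:(nia); nia.
have {}many z : #|copartners F z| <= 2.
  by move: many; rewrite negb_exists => /forallP/(_ z); rewrite -leqNgt.
have [/existsP[x /set0Pn[y yx]]|none] := boolP [exists x, copartners F x != set0].
  have HF := card_few_copartners kT unifF intF ntF yx many.
  (* For [k = 3] the bound is [3 * codeg #|T| 3 2 + 8], too large for [lt_bin_of_codeg_le]. With
     [codeg #|T| 3 2 = #|T| - 2] the claim is a cubic inequality for [#|T| >= 34], the value of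
     [order_bound 3]. *)
  have [e|k3] := eqVneq k 3.
    have e23 := @codeg23 #|T| k k2 kT ltac:(lia).
    have e02 := @codeg02 #|T| k k2 kT.
    have e3 : codeg #|T| k 3 = 1 by rewrite e /codeg binn.
    have n34 : 34 <= #|T| by move: hn; rewrite e.
    move: HF e23 e02; rewrite e3 e /= => HF.
    rewrite muln1 mul1n => e23 e02; rewrite -e23 in HF e02.
    rewrite -(@ltn_pmul2l 6) // -[6]/(3 * (3 - 1)) -e02.
    move: HF n34; rewrite /= muln1 -[(2 ^ 2)%N]/4.
    move: #|F| #|T| => f n HF n34.
    apply: leq_ltn_trans (_ : 6 * ((2 * n - 11) * (3 * n + 2)) < _).
      by rewrite leq_mul2l leq_mul //; lia.
    move/subnKC: n34 => <-; move: (n - 34) => r.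
    have -> : 2 * (34 + r) - 11 = 57 + 2 * r by lia.
    have -> : 34 + r - 1 = 33 + r by lia.
    have -> : 34 + r - 2 = 32 + r by lia.
    have -> : (34 + r) * (33 + r) * (32 + r) =
        6 * ((57 + 2 * r) * (3 * (34 + r) + 2))
          + (992 * r + 63 * (r * r) + r * r * r + 336) by lia.
    by rewrite -[ltnLHS]addn0 ltn_add2l addnS.
  apply: lt_bin_of_codeg_le => //; apply: leq_trans HF _.
  (* For [k = 2] triples have codegree [0] and the bound [3] is exactly [2 * 1 + 1]. For [k >= 4]
     the triple term fits into a fourth pair codegree. *)
  have [e|k4] := eqVneq k 2.
    by rewrite e /codeg binn bin_small //; lia.
  have := c3le (2 * k.-1 ^ 2) ltac:(lia); rewrite -mulnA => c3.
  have : 4 * codeg #|T| k 2 <= k * codeg #|T| k 2 by rewrite leq_mul2r; lia.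
  by lia.
apply: lt_bin_of_codeg_le => //; apply: leq_trans (card_no_cover kT unifF intF Fn0 _) _.
  by move=> x; apply/eqP; move: none; rewrite negb_exists => /forallP/(_ x)/negPn.
have := c3le (k ^ 2) ltac:(nia); rewrite expnS -mulnA.
have : 0 < k by lia.
by nia.
Qed.

(** * Star-free colorings in arithmetic form *)

Lemma star_free_coloringE (G : sgraph) (c : G -> nat) :
  star_free_coloring c <->
  proper_coloring c /\ forall u v w : G, path3 u v w -> c u = c w ->
    ~ (c v = (c u).+1 \/ c u = (c v).+1).
Proof.
split=> -[pc H]; split=> // u v w uvw.
  move=> cuw cv; apply: (H _ _ _ uvw); case: cv => cv.
    exists (c u) => x; rewrite !inE => /or3P[] /eqP->; lia.
  exists (c v) => x; rewrite !inE => /or3P[] /eqP->; lia.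
(* Properness makes two colors alternate along the path, so its ends agree. *)
case=> i ci; have [uv vw _] := uvw.
have nuv := pc _ _ uv; have nvw := pc _ _ vw.
have cu := ci u ltac:(by rewrite !inE eqxx).
have cv := ci v ltac:(by rewrite !inE eqxx orbT).
have cw := ci w ltac:(by rewrite !inE eqxx !orbT).
apply: (H _ _ _ uvw); lia.
Qed.

Lemma star_free_chromatic_le (G : sgraph) (t : nat) :
  0 < t -> star_free_colorable G t -> star_free_chromatic G <= t.
Proof.
move=> t0 Ht; rewrite /star_free_chromatic; case: ex_minnP => m _; apply.
by rewrite t0; apply/asboolP.
Qed.

Lemma star_free_chromaticP (G : sgraph) :
  0 < star_free_chromatic G /\ star_free_colorable G (star_free_chromatic G).
Proof.
by rewrite /star_free_chromatic; case: ex_minnP => m /andP[m0 /asboolP].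
Qed.

(** * Adding and deleting a point of the ground set *)

Lemma lift_setP (n k : nat) (x : 'I_n.+1) (A : ksubset n k) :
  #|lift x @: val A| == k.
Proof. by rewrite card_imset ?(valP A) //; apply: lift_inj. Qed.

(** Since [lift x] skips [x], this embeds the smaller Kneser graph as the subgraph induced on the
    sets avoiding [x]. *)
Definition lift_set (n k : nat) (x : 'I_n.+1) (A : ksubset n k) : ksubset n.+1 k :=
  Sub (lift x @: val A) (lift_setP x A).

Lemma notin_lift_set (n k : nat) (x : 'I_n.+1) (A : ksubset n k) :
  x \notin val (lift_set x A).
Proof. by apply/imsetP => -[i _ /eqP]; rewrite (negPf (neq_lift _ _)). Qed.

Lemma lift_set_inj (n k : nat) (x : 'I_n.+1) :
  injective (@lift_set n k x).
Proof.
move=> A B /(congr1 val) /= /imset_inj AB; apply: val_inj.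
by apply: AB; apply: lift_inj.
Qed.

Lemma lift_set_surj (n k : nat) (x : 'I_n.+1) (A : ksubset n.+1 k) :
  x \notin val A -> exists B : ksubset n k, lift_set x B = A.
Proof.
move=> xA; pose B := lift x @^-1: val A.
have AB : lift x @: B = val A.
  apply/setP => i; apply/imsetP/idP => [[j]|iA]; first by rewrite inE => jA ->.
  case: (unliftP x i) iA => [j ->|->] iA; last by rewrite iA in xA.
  by exists j; rewrite ?inE.
have Bk : #|B| == k.
  by rewrite -(card_imset _ (@lift_inj _ x)) AB (valP A).
exists (Sub B Bk); apply: val_inj; exact: AB.
Qed.

Lemma lift_set_adj (n k : nat) (x : 'I_n.+1) (A B : kneser n k) :
  @adj (kneser n.+1 k) (lift_set x A) (lift_set x B) = adj A B.
Proof.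
rewrite /= /kneser_adj (inj_eq (@lift_set_inj _ _ x)) /=; congr andb.
rewrite -imsetI; last by move=> i j _ _; apply: lift_inj.
by rewrite -!cards_eq0 card_imset //; apply: lift_inj.
Qed.

Lemma disjoint_adj (n k : nat) (A B : kneser n k) :
  0 < k -> val A :&: val B = set0 -> adj A B.
Proof.
move=> k0 AB; rewrite /= /kneser_adj AB eqxx andbT.
apply: contraTneq k0 => eAB; move: AB; rewrite eAB setIid => B0.
by rewrite -(eqP (valP B)) B0 cards0.
Qed.

(** The sets through the new point pairwise intersect and all get color [t.+2]. Color [t.+1] stays
    empty, so [t.+2] has no consecutive color in use. *)
Lemma kneser_colorable_succ (n k t : nat) :
  star_free_colorable (kneser n k) t ->
  star_free_colorable (kneser n.+1 k) t.+2.
Proof.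
move=> [c [/star_free_coloringE[pc sc] ct]].
pose g (A : kneser n.+1 k) := [pick B : ksubset n k | lift_set ord_max B == A].
pose c' A := if g A is Some B then c B else t.+2.
have gP (A : kneser n.+1 k) : (ord_max \in val A /\ c' A = t.+2)
    \/ exists2 B, A = lift_set ord_max B & c' A = c B /\ c B <= t.
  rewrite /c' /g; case: pickP => [B /eqP<-|none].
    by right; exists B => //; case/andP: (ct B).
  left; split=> //; apply/negPn/negP => /lift_set_surj[B /eqP].
  by rewrite none.
have noadj (A B : kneser n.+1 k) :
      ord_max \in val A -> ord_max \in val B -> ~ @adj (kneser n.+1 k) A B.
  by move=> xA xB /andP[_ /eqP/setP/(_ ord_max)]; rewrite inE xA xB inE.
exists c'; split; last first.
  move=> A; case: (gP A) => [[_ ->]|[B _ [-> _]]]; first by rewrite leqnn.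
  by have := ct B; lia.
apply/star_free_coloringE; split=> [A B AB|A B C [AB BC AC]].
  case: (gP A) (gP B) => [[xA ->]|[A' eA [-> At]]] [[xB ->]|[B' eB [-> Bt]]];
    try by lia.
    by case: (noadj _ _ xA xB AB).
  by apply: pc; rewrite -(lift_set_adj ord_max) -eA -eB.
case: (gP A) (gP B) (gP C) => [[xA ->]|[A' eA [-> At]]]
    [[xB ->]|[B' eB [-> Bt]]] [[xC ->]|[C' eC [-> Ct]]]; try by lia.
apply: sc; split.
- by rewrite -(lift_set_adj ord_max) -eA -eB.
- by rewrite -(lift_set_adj ord_max) -eC -eB.
- by apply: contraNneq AC => e; rewrite eA eC e.
Qed.

(** Adjacent sets are complementary, so no path has three vertices, and containing [x] separates a
    set from its complement. *)
Lemma kneser_colorable_double (k : nat) :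
  0 < k -> star_free_colorable (kneser (2 * k) k) 2.
Proof.
case: k => // k _; pose x : 'I_(2 * k.+1) := ord0.
have adjC (A B : kneser (2 * k.+1) k.+1) : adj A B -> val B = ~: val A.
  case/andP=> _ /eqP AB; apply/eqP; rewrite eqEcard -disjoints_subset.
  rewrite -setI_eq0 setIC AB eqxx /= [#|~: _|]cardsCs setCK card_ord.
  by rewrite (eqP (valP A)) (eqP (valP B)); lia.
exists (fun A : kneser (2 * k.+1) k.+1 => if x \in val A then 1 else 2).
split; last by move=> A; case: ifP.
apply/star_free_coloringE; split=> [A B /adjC->|A B C [AB BC]].
  by rewrite inE; case: ifP.
case/negP; apply/eqP/val_inj.
by rewrite (adjC _ _ BC) (adjC _ _ AB) setCK.
Qed.

Lemma kneser_colorable (n k : nat) :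
  0 < k -> 2 * k <= n -> star_free_colorable (kneser n k) (2 * n - 4 * k + 2).
Proof.
move=> k0 /subnKC<-; elim: (n - 2 * k) => [|m IH].
  rewrite addn0 (_ : _ + 2 = 2); [exact: kneser_colorable_double | lia].
rewrite addnS (_ : _ + 2 = (2 * (2 * k + m) - 4 * k + 2).+2); last lia.
exact: kneser_colorable_succ.
Qed.

Lemma kneser_colorable_pred (n k t i : nat) (x : 'I_n.+1)
    (c : kneser n.+1 k -> nat) :
  star_free_coloring c -> (forall A, 1 <= c A <= t) -> 0 < i <= t ->
  (forall A : kneser n.+1 k, i <= (c A).+1 -> c A <= i.+1 -> x \in val A) ->
  star_free_colorable (kneser n k) (t - 2).
Proof.
move=> /star_free_coloringE[pc sc] ct it cx.
have far A : (c (lift_set x A)).+1 < i \/ i.+1 < c (lift_set x A).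
  have := notin_lift_set x A; have := cx (lift_set x A).
  by case: (x \in _); lia.
(* Low colors end at [i - 2] and shifted high colors start at [i]; the gap at [i - 1] prevents new
   consecutive pairs. *)
exists (fun A => let a := c (lift_set x A) in if a < i then a else a - 2).
split; last first.
  by move=> A /=; have := ct (lift_set x A); have := far A; case: ifP; lia.
apply/star_free_coloringE; split=> [A B AB|A B C [AB BC AC]] /=.
  have /pc : @adj (kneser n.+1 k) (lift_set x A) (lift_set x B).
    by rewrite lift_set_adj.
  by have := far A; have := far B; do 2 case: ifP; lia.
have /sc : @path3 (kneser n.+1 k) (lift_set x A) (lift_set x B) (lift_set x C).
  by split; rewrite ?lift_set_adj ?(inj_eq (@lift_set_inj _ _ x)).
by have := far A; have := far B; have := far C; do 3 case: ifP; lia.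
Qed.

(** * Color classes as set families *)

Definition color_class (n k : nat) (c : kneser n k -> nat) (i : nat) :
    {set {set 'I_n}} :=
  val @: [set A : ksubset n k | c A == i].

Lemma color_classP (n k : nat) (c : kneser n k -> nat) (i : nat) (S : {set 'I_n}) :
  reflect (exists2 A : kneser n k, S = val A & c A = i) (S \in color_class c i).
Proof.
apply: (iffP imsetP) => [[A + ->]|[A -> <-]]; last by exists A; rewrite ?inE.
by rewrite inE => /eqP; exists A.
Qed.

Lemma card_ksubset (n k : nat) : #|ksubset n k| = 'C(n, k).
Proof.
rewrite card_sig -[in RHS](card_ord n) -cardsT -cards_draws.
by apply: eq_card => A; rewrite !inE subsetT.
Qed.

Lemma card_color_class (n k : nat) (c : kneser n k -> nat) (i : nat) :
  #|color_class c i| = #|[set A : ksubset n k | c A == i]|.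
Proof. by apply: card_imset; apply: val_inj. Qed.

Lemma large_color_class (n k s t : nat) (c : kneser n k -> nat) :
  k <= n -> t <= s -> (forall A, 1 <= c A <= t) ->
  exists2 i, 0 < i <= t & 'C(n, k) <= s * #|color_class c i|.
Proof.
move=> kn ts ct; have M0 : 0 < 'C(n, k) by rewrite bin_gt0.
have sumV : \sum_(i < t) #|color_class c i.+1| = 'C(n, k).
  rewrite -card_ksubset -sum1_card.
  rewrite (eq_bigr (fun i : 'I_t =>
    \sum_(A in [set A : ksubset n k | c A == i.+1]) 1)); last first.
    by move=> i _; rewrite card_color_class sum1_card.
  rewrite (exchange_big_dep predT) //=; apply: eq_bigr => A _.
  have cA : (c A).-1 < t by have := ct A; lia.
  rewrite (bigD1 (Ordinal cA)) ?inE /=; last by have := ct A; lia.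
  rewrite big1 // => i; rewrite inE -val_eqE /= => /andP[/eqP-> ].
  by rewrite eqxx.
have [/existsP[i Hi]|] := boolP [exists i : 'I_t, 'C(n, k) <= s * #|color_class c i.+1|].
  by exists i.+1 => //=.
rewrite negb_exists => /forallP small.
(* Pigeonhole without division: summing over [t <= s] classes that are all too small gives a
   contradiction. *)
have : s * 'C(n, k) <= t * 'C(n, k).-1.
  rewrite -sumV big_distrr /= -[t in t * _]card_ord -sum_nat_const sumV.
  by apply: leq_sum => i _; rewrite -ltnS (prednK M0) ltnNge small.
have s0 : 0 < s.
  rewrite lt0n; apply/eqP => s0; have t0 : t = 0 by lia.
  by move: M0; rewrite -sumV t0 big_ord0.
move/leq_trans/(_ (leq_mul ts (leqnn _))).
by rewrite leq_pmul2l //; lia.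
Qed.

Lemma star_color_class (n k t : nat) (c : kneser n k -> nat) :
  2 <= k -> order_bound k <= n -> t <= 2 * n - 4 * k + 1 ->
  star_free_coloring c -> (forall A, 1 <= c A <= t) ->
  exists x i, 0 < i <= t /\
    forall A : kneser n k, i <= (c A).+1 -> c A <= i.+1 -> x \in val A.
Proof.
move=> k2 hn ts /star_free_coloringE[pc sc] ct.
have k0 : 0 < k by lia.
have kn : k <= n by have [_ [_]] := order_bound_ge k2 hn; lia.
have [i it big] := large_color_class kn ts ct.
set F := color_class c i in big.
have unifF : uniform k F by move=> _ /color_classP[A -> _]; exact: (eqP (valP A)).
have intF : intersecting F.
  move=> _ _ /color_classP[A -> cA] /color_classP[B -> cB].
  apply/negP => /eqP /(disjoint_adj k0) /pc; lia.
have [[x xF]|ntF] := pselect (exists x, forall A, A \in F -> x \in A); last first.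
  have ntF' : nontrivial F.
    move=> x; apply/exists_inP; apply: contra_notT ntF => /exists_inPn H.
    by exists x => A /H /negPn.
  have := @nontrivial_card_small _ _ F k2; rewrite card_ord => /(_ hn unifF intF ntF').
  by rewrite ltnNge big.
exists x, i; split=> // B iB Bi; apply: contraLR big => xB; rewrite -ltnNge.
apply: lt_bin_of_codeg_le => //.
have cB : c B <> i.
  by move=> cB; move/negP: xB; apply; apply: xF; apply/color_classP; exists B.
(* Members meeting [B] contain [x] and a point of [B], which gives [k * codeg n k 2]; those disjoint
   from [B] account for the [1]. *)
rewrite -(cardsID [set A : {set 'I_n} | A :&: val B != set0] F); apply: leq_add.
  set F' := _ :&: _; have FF' A : A \in F' -> A \in F by rewrite inE => /andP[].
  have unifF' : uniform k F' by move=> A /FF'/unifF.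
  have := @deg1_le _ k F' x (val B); rewrite card_ord (eqP (valP B)).
  move=> /(_ kn unifF' xB) deg1.
  apply: leq_trans (deg1 _); last by move=> A; rewrite !inE => /andP[].
  apply/subset_leq_card/subsetP => A AF'; rewrite inE AF' sub1set.
  exact/xF/FF'.
(* Two members disjoint from [B] would be the ends of a path through [B] colored with consecutive
   integers. *)
apply/card_le1_eqP => S S' /setDP[/color_classP[A -> cA] AB].
move=> /setDP[/color_classP[A' -> cA'] A'B].
move: AB A'B; rewrite !inE !negbK => /eqP AB /eqP A'B.
apply/eqP/negPn/negP => AA'.
apply: (sc A B A'); last 2 first.
- by rewrite cA cA'.
- by rewrite cA; lia.
split; first by exact: disjoint_adj AB.
  by rewrite adj_sym; exact: disjoint_adj A'B.
by apply: contraNneq AA' => ->.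
Qed.

Theorem theorem1 (n k : nat)
    (hn : 0 < n) (hk : 0 < k)
    (hnk : 2 * k <= n) (hk4 : 4 <= 2 * k)
    (hbound : 2 * k ^ 3 - 2 * k ^ 2 - 2 * k + 4 <= n) :
  star_free_chromatic (kneser n k) = star_free_chromatic (kneser (n - 1) k) + 2.
Proof.
have k2 : 2 <= k by lia.
have [_ [_ n1k]] := order_bound_ge k2 hbound.
case: n hn hnk hbound n1k => // n _ hnk hbound; rewrite subn1 /= => n1k.
have [chi_gt0 chi_col] := star_free_chromaticP (kneser n k).
have [t_gt0 [c [cs ct]]] := star_free_chromaticP (kneser n.+1 k).
apply/eqP; rewrite eqn_leq; apply/andP; split.
  by rewrite addn2; apply/star_free_chromatic_le/kneser_colorable_succ.
have chi_le : star_free_chromatic (kneser n k) <= 2 * n - 4 * k + 2.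
  by apply: star_free_chromatic_le; [lia | apply: kneser_colorable].
(* Here [n] is one less than the original order, so [lt_t] and [chi_le] allow at most
   [2 * n.+1 - 4 * k + 1] colors, as [star_color_class] requires. *)
rewrite leqNgt; apply/negP => lt_t.
have [|x [i [it cx]]] := star_color_class k2 hbound _ cs ct; first by lia.
have col := kneser_colorable_pred cs ct it cx.
(* The chromatic number is a minimum over positive integers, so zero colors must be excluded; the
   graph has a vertex. *)
have t2 : 0 < star_free_chromatic (kneser n.+1 k) - 2.
  rewrite lt0n; apply/eqP => e; move: col; rewrite e => -[c' [_ c't]].
  have /card_gt0P[A _] : 0 < #|ksubset n k|.
    by rewrite card_ksubset bin_gt0; lia.
  by have := c't A; lia.
by have := star_free_chromatic_le t2 col; lia.
Qed.
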